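(* Let $d\ge1$, $1\le n\le N\le\infty$ with $n$ finite, and let all the random variables $\xi(i,m)$, $n\le i\le N$ ($i$ finite), $m=1,\dots,d$, be centered and (totally, jointly) independent. Put $\nu_m^{(n)}(p)=\sup_{n\le i\le N}|\xi(i,m)|_p$ and assume that, for each $m$, $\nu_m^{(n)}\in G(\nu,r_m)$ for some $2<r_m\le\infty$. Define for $p\ge2$, by reverse recursion, $$\zeta_d(p)=K_I(p)\,\nu_d^{(n)}(p),\qquad \zeta_m(p)=K_M(p)\,\zeta_{m+1}(p)\,\nu_m^{(n)}(p),\quad m=d-1,d-2,\dots,1,$$ that is, $\zeta_1(p)=K_I(p)\,K_M^{d-1}(p)\prod_{m=1}^d\nu_m^{(n)}(p)$. Then $$\sup_{b\in B}\|V_n^{(N)}(d,b)\|G(\zeta_1)\ \le\ \prod_{m=1}^d\|\vec\xi(m)\|G(\nu_m^{(n)},r_m),$$ where, with $s=\min_m r_m$, $\|V\|G(\zeta_1)=\sup_{p\in(2,s)}|V|_p/\zeta_1(p)$ and $\|\vec\xi(m)\|G(\nu_m^{(n)},r_m)=\sup_{p\in(2,r_m)}\sup_{n\le i\le N}|\xi(i,m)|_p/\nu_m^{(n)}(p)$.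
   Context: All random variables live on one probability space; $|\xi|_p=(\mathbf E|\xi|^p)^{1/p}$; $\vec\xi(m)=\{\xi(i,m)\}_i$. Suprema of nonnegative quantities over the empty set are $0$. Polynomial: $I_n^{(N)}(d)=\{(i_1,\dots,i_d):n\le i_1<i_2<\dots<i_d\le N\}$ (finite indices); for a real non-random array $b=(b(I))$ indexed by $I_n^{(N)}(d)$, $$V_n^{(N)}(d,b)=\sum_{I=(i_1,\dots,i_d)\in I_n^{(N)}(d)}b(I)\prod_{m=1}^d\xi(i_m,m).$$ For $N=\infty$ the sum is understood as the limit as $N\to\infty$ of the sums for finite $N$, for those $b$ for which this limit exists with probability one. $B=\{b:\sum_{I\in I_n^{(N)}(d)}b^2(I)=1\}$. Class $G(\nu,r)$ ($2<r\le\infty$): functions $\nu$ that are continuous, positive and finite on $[1,r)$, with $\inf_{p\in(2,r)}\nu(p)>0$ and $\nu(p)=\infty$ for $p>r$. Constant $K_M(p)$, $p\ge2$: the smallest constant $K$ such that for every finite $n$, every sequence $\theta(1),\dots,\theta(n)$ of centered martingale differences relative to some filtration, and all real $b(1),\dots,b(n)$ with $\sum_i b^2(i)=1$, one has $\left|\sum_{i=1}^n b(i)\theta(i)\right|_p\le K\sup_i|\theta(i)|_p$. (It is known that $K_M(p)\le p\sqrt2$.) Constant $K_I(p)$, $p\ge2$: the smallest constant in the same inequality when $\theta(1),\dots,\theta(n)$ are restricted to be independent centered random variables. (It is known that $K_I(p)\le 0.87\,p/\log p$.) *)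

(* Defs.v *)
From HB Require Import structures.
From mathcomp Require Import all_boot all_order all_algebra finmap.
From mathcomp Require Import all_classical all_reals all_analysis.

Set Implicit Arguments.
Unset Strict Implicit.
Unset Printing Implicit Defensive.
Import Order.TTheory GRing.Theory Num.Theory.
Import numFieldNormedType.Exports.

Local Open Scope classical_set_scope.
Local Open Scope ring_scope.

(* Adjoining 0 only matters for [A = set0], where [ereal_sup] is -oo but a
   supremum of nonnegative quantities is meant to be 0. *)
Definition nnsup (R : realType) (A : set (\bar R)) : \bar R :=
  ereal_sup (A `|` [set 0%E]).

(* The upper bound [N] of an index range; [None] is N = infinity. *)
Definition in_range (n : nat) (N : option nat) (i : nat) : bool :=
  (n <= i)%N && (if N is Some N' then (i <= N')%N else true).

Definition Iset (n : nat) (N : option nat) (d : nat) : set (d.-tuple nat) :=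
  [set I | sorted ltn I /\ all (in_range n N) I].

(* In particular the sum over [Iset] in [polyV_fin] below is a genuine one
   ([\sum_(I \in A)] is 0 on families of infinite support). *)
Lemma finite_Iset (n N d : nat) : finite_set (@Iset n (Some N) d).
Proof.
apply: (@sub_finite_set _ _
  [set map_tuple (@nat_of_ord N.+1) J | J in [set: d.-tuple 'I_N.+1]]).
  move=> I [_ /allP IN]; exists (map_tuple (@inord N) I) => //.
  apply/val_inj => /=; rewrite -map_comp -[RHS]map_id; apply/eq_in_map.
  by move=> i /IN /andP[_ iN] /=; rewrite inordK.
exact/finite_image/finite_finset.
Qed.

(* Real coefficient arrays; only the values on [Iset n N d] are ever used. *)
Definition coefs (R : realType) (d : nat) := d.-tuple nat -> R.

Definition unit_coefs (R : realType) (n : nat) (N : option nat) (d : nat) :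
    set (coefs R d) :=
  [set b | \esum_(I in @Iset n N d) ((b I) ^+ 2)%:E = 1%E].

Section random_variables.
Context {disp : measure_display} {T : measurableType disp} {R : realType}.
Variable P : probability T R.

Definition pnorm (p : R) (X : T -> R) : \bar R :=
  ('N[P]_(p%:E)[EFin \o X])%E.

Definition centered (X : T -> R) : Prop :=
  P.-integrable [set: T] (EFin \o X) /\ ('E_P[X] = 0)%E.

(* Mutual independence of the subfamily of [X] indexed by [D]. *)
Definition independent_RVs (I : choiceType) (D : set I)
    (X : I -> {RV P >-> R}) : Prop :=
  forall J : {fset I}, [set` J] `<=` D ->
  forall B : I -> set R, (forall i, measurable (B i)) ->
    P (\bigcap_(i in [set` J]) (X i @^-1` B i)) =
    (\prod_(i <- J) P (X i @^-1` B i))%E.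

Definition filtration (F : nat -> set (set T)) : Prop :=
  [/\ forall i, sigma_algebra [set: T] (F i),
      forall i, F i `<=` measurable
    & forall i j, (i <= j)%N -> F i `<=` F j].

Definition measurable_wrt (G : set (set T)) (X : T -> R) : Prop :=
  forall B : set R, measurable B -> G (X @^-1` B).

(* [Y] is a version of the conditional expectation of [X] given [G]. *)
Definition is_condexp (G : set (set T)) (X Y : T -> R) : Prop :=
  [/\ measurable_wrt G Y, P.-integrable [set: T] (EFin \o Y)
    & forall A, G A -> (\int[P]_(w in A) (Y w)%:E = \int[P]_(w in A) (X w)%:E)%E].

(* theta(1), ..., theta(n) are numbered theta 0, ..., theta n.-1. *)
Definition centered_martingale_differences (n : nat)
    (theta : nat -> {RV P >-> R}) : Prop :=
  exists F : nat -> set (set T),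
  [/\ filtration F,
      forall i, (i < n)%N -> measurable_wrt (F i) (theta i),
      forall i, (i < n)%N -> centered (theta i)
    & forall i, (i.+1 < n)%N -> is_condexp (F i) (theta i.+1) (cst 0)].

Definition independent_centered (n : nat) (theta : nat -> {RV P >-> R}) : Prop :=
  independent_RVs [set i | (i < n)%N] theta /\
  forall i, (i < n)%N -> centered (theta i).

(* The smallest constant K in the inequality
     |\sum_i b(i) theta(i)|_p <= K sup_i |theta(i)|_p,  \sum_i b(i)^2 = 1,
   over the sequences theta on the given probability space that belong to
   [C]; it is +oo if there is no such K. The constant that is uniform over all
   probability spaces can only be larger. *)
Definition best_constant (C : nat -> (nat -> {RV P >-> R}) -> Prop) (p : R) :
    \bar R :=
  ereal_inf [set K%:E | K in [set K : R | 0 <= K /\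
    forall (n : nat) (theta : nat -> {RV P >-> R}) (b : nat -> R),
      C n theta -> \sum_(i < n) b i ^+ 2 = 1 ->
      (pnorm p (fun w => (\sum_(i < n) b i * theta i w)%R)
        <= K%:E * nnsup [set pnorm p (theta i) | i in [set i | (i < n)%N]])%E]].

Definition KM (p : R) : \bar R :=
  best_constant centered_martingale_differences p.

Definition KI (p : R) : \bar R := best_constant independent_centered p.

Definition exponents (r : \bar R) : set R := [set p | 2 < p /\ (p%:E < r)%E].

(* The class G(nu, r). *)
Definition Gclass (r : \bar R) (nu : R -> \bar R) : Prop :=
  [/\ {within [set p : R | 1 <= p /\ (p%:E < r)%E], continuous nu},
      forall p : R, 1 <= p -> (p%:E < r)%E -> (0 < nu p /\ nu p < +oo)%E,
      (0 < ereal_inf [set nu p | p in exponents r])%E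
    & forall p : R, (r < p%:E)%E -> nu p = +oo%E].

(* sup_{2 < p < r} |X|_p / psi(p) *)
Definition Gnorm (psi : R -> \bar R) (r : \bar R) (X : T -> R) : \bar R :=
  nnsup [set (pnorm p X / psi p)%E | p in exponents r].

(* sup_{2 < p < r} sup_{i in D} |X i|_p / psi(p) *)
Definition Gnorm_family (psi : R -> \bar R) (r : \bar R) (D : set nat)
    (X : nat -> T -> R) : \bar R :=
  nnsup [set nnsup [set (pnorm p (X i) / psi p)%E | i in D]
       | p in exponents r].

Section polynomial.
Variables (d : nat) (xi : nat -> 'I_d -> {RV P >-> R}).

Definition polyV_fin (n N : nat) (b : coefs R d) (w : T) : R :=
  \sum_(I \in @Iset n (Some N) d) (b I * \prod_(m < d) xi (tnth I m) m w).

(* For N = infinity, almost sure convergence of the finite sums. *)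
Definition polyV_defined (n : nat) (N : option nat) (b : coefs R d) : Prop :=
  if N is Some _ then True
  else {ae P, forall w, cvgn (fun k => polyV_fin n k b w)}.

Definition polyV (n : nat) (N : option nat) (b : coefs R d) (w : T) : R :=
  if N is Some N' then polyV_fin n N' b w
  else limn (fun k => polyV_fin n k b w).

Definition nu (n : nat) (N : option nat) (m : 'I_d) (p : R) : \bar R :=
  nnsup [set pnorm p (xi i m) | i in [set i | in_range n N i]].

End polynomial.

End random_variables.

(* Applied to [:: nu_m; ...; nu_d], this is zeta_m:
   zeta_d = kI * nu_d  and  zeta_m = kM * zeta_{m+1} * nu_m. *)
Fixpoint zeta_rec (R : realType) (kI kM : \bar R) (v : seq (\bar R)) : \bar R :=
  match v with
  | [::] => 1%E
  | [:: x] => (kI * x)%E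
  | x :: v' => (kM * zeta_rec kI kM v' * x)%E
  end.

Definition zeta1 {disp : measure_display} {T : measurableType disp}
    {R : realType} (P : probability T R) (d : nat)
    (xi : nat -> 'I_d -> {RV P >-> R}) (n : nat) (N : option nat) (p : R) :
    \bar R :=
  zeta_rec (KI P p) (KM P p) [seq nu xi n N m p | m <- enum 'I_d].

(* Main.v *)
Require Import Defs.
From HB Require Import structures.
From mathcomp Require Import all_boot all_order all_algebra finmap.
From mathcomp Require Import all_classical all_reals all_analysis.
From mathcomp Require Import measurable_realfun zify.

(* By definition of [nu], the quotients [|xi(i,m)|_p / nu_m(p)] have supremum 1
   for every [p < r_m], so the right-hand side is at least 1 and it suffices to
   show [|V|_p <= zeta_1(p)] for a single [p].

   For finite [N] this goes by induction on [d], splitting the polynomial along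
   its smallest index: V_n = sum_i xi(i,1) W_i, where W_i is a polynomial of
   degree [d-1] in the variables with first index [> i]. Read from [i = N] down
   to [i = n], the summands are martingale differences for the sigma-algebras
   generated by the [xi(j,m)] with [j >= i], because [xi(i,1)] is centered and
   independent of everything with a larger first index. By independence also
   [|xi(i,1) W_i|_p = |xi(i,1)|_p |W_i|_p]; normalizing the [W_i] by the l2
   norms of their coefficients, whose squares add up to 1, yields the factor
   [K_M(p) nu_1(p)]. In degree 1 the summands are independent, which gives
   [K_I(p) nu_d(p)]. The case [N = oo] follows by Fatou's lemma.

   Finiteness of [K_M] and [K_I] is never needed: if [zeta_1(p) = +oo], then the
   quotient [|V|_p / zeta_1(p)] is 0. That 0 times [+oo] does not occur in
   [zeta_1] is due to [K_I, K_M >= 1], which holds as some [xi(i,m)] is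
   nonzero. *)

Set Implicit Arguments.
Unset Strict Implicit.
Unset Printing Implicit Defensive.
Import Order.TTheory GRing.Theory Num.Theory.
Import numFieldNormedType.Exports.

Local Open Scope classical_set_scope.
Local Open Scope ring_scope.

(** * Independence of sigma-algebras *)

Section independence.
Context {disp : measure_display} {T : measurableType disp} {R : realType}.
Variable P : probability T R.
Implicit Types I : choiceType.

(** The left inverse [g] makes [f] injective on [D'] and carries the Borel sets indexed by [I'] over
    to [I]. Later uses extract one column, drop the first column or single out one variable. *)
Lemma independent_RVs_reindex I I' (D : set I) (D' : set I')
    (X : I -> {RV P >-> R}) (f : I' -> I) (g : I -> I') :
  (forall j, D' j -> g (f j) = j) -> (forall j, D' j -> D (f j)) ->
  independent_RVs D X -> independent_RVs D' (X \o f).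
Proof.
move=> gf fD indX J JD' B mB.
have finj : {in J &, injective f}.
  by move=> i j iJ jJ fij; rewrite -(gf i (JD' _ iJ)) fij gf//; exact: JD'.
have := indX [fset f j | j in J]%fset _ (B \o g) (fun i => mB (g i)).
rewrite big_imfset//= => indJ.
rewrite (_ : \bigcap_(i in _) _ =
  \bigcap_(i in [set` [fset f j | j in J]%fset]) (X i @^-1` B (g i))).
  rewrite indJ; last by move=> _ /imfsetP[j /= jJ ->]; exact/fD/JD'.
  rewrite big_seq [RHS]big_seq; apply: eq_bigr => j jJ /=.
  by rewrite gf//; exact: JD'.
apply/seteqP; split=> w /= Xw.
  by move=> _ /imfsetP[j /= jJ ->] /=; rewrite gf; [exact: Xw|exact: JD'].
move=> j /= jJ; have := Xw (f j); rewrite /= gf; last exact: JD'.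
by apply; apply/imfsetP; exists j.
Qed.

Definition generators I (D : set I) (X : I -> {RV P >-> R}) : set (set T) :=
  [set A | exists i B, [/\ D i, measurable B & A = X i @^-1` B]].

Lemma generators_measurable I (D : set I) (X : I -> {RV P >-> R}) :
  generators D X `<=` measurable.
Proof. by move=> _ [i [B [_ mB ->]]]; exact: measurable_funPTI. Qed.

Lemma sigma_generators_measurable I (D : set I) (X : I -> {RV P >-> R}) :
  <<s generators D X >> `<=` measurable.
Proof.
apply: smallest_sub; last exact: generators_measurable.
exact: sigma_algebra_measurable.
Qed.

(** The pi-system that generates the sigma-algebra of the variables in [D]; [independent_RVs] speaks
    directly of these sets. *)
Definition cylinders I (D : set I) (X : I -> {RV P >-> R}) : set (set T) :=
  [set A | exists (J : {fset I}) (B : I -> set R),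
    [/\ [set` J] `<=` D, forall i, measurable (B i)
      & A = \bigcap_(i in [set` J]) (X i @^-1` B i)]].

Lemma cylinders_setI I (D : set I) (X : I -> {RV P >-> R}) :
  setI_closed (cylinders D X).
Proof.
move=> _ _ [J1 [B1 [J1D mB1 ->]]] [J2 [B2 [J2D mB2 ->]]].
exists (J1 `|` J2)%fset.
(* Outside its own finite set each family is filled up with the whole line, so that both live on the
   union. *)
exists (fun i => (if i \in J1 then B1 i else setT) `&`
                 (if i \in J2 then B2 i else setT)); split.
- by move=> i /=; rewrite in_fsetU => /orP[/J1D|/J2D].
- by move=> i; apply: measurableI; case: ifP.
apply/seteqP; split=> w.
  by move=> [w1 w2] i /= _; split; case: ifP => // ?; [exact: w1|exact: w2].
move=> w12; split=> i /= iJ.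
  by have := w12 i; rewrite /= in_fsetU iJ /= => /(_ isT)[].
by have := w12 i; rewrite /= in_fsetU iJ orbT /= => /(_ isT)[].
Qed.

Lemma generators_cylinders I (D : set I) (X : I -> {RV P >-> R}) :
  generators D X `<=` cylinders D X.
Proof.
move=> _ [i [B [Di mB ->]]]; exists [fset i]%fset, (fun _ => B); split => //.
  by move=> j /=; rewrite in_fset1 => /eqP ->.
apply/seteqP; split=> w /=.
  by move=> Xw j /=; rewrite in_fset1 => /eqP ->.
by move/(_ i); apply; rewrite /= in_fset1.
Qed.

(** Dynkin's argument: the events independent of the fixed event [C] form a lambda-system, and it
    contains the pi-system of cylinders. *)
Lemma independent_sigma I (D D' : set I) (X : I -> {RV P >-> R}) (i0 : I) A B :
  independent_RVs D X -> D' `<=` D -> D i0 -> ~ D' i0 ->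
  <<s generators D' X >> A -> measurable B ->
  P (A `&` X i0 @^-1` B) = (P A * P (X i0 @^-1` B))%E.
Proof.
move=> indX D'D Di0 D'i0 sA mB; set C := X i0 @^-1` B.
have mC : measurable C by exact: measurable_funPTI.
pose H := [set A | measurable A /\ P (A `&` C) = (P A * P C)%E].
suff : <<s cylinders D' X >> `<=` H.
  move=> HA; apply: (proj2 (HA A _)); move: sA; apply: sub_sigma_algebra2.
  exact: generators_cylinders.
apply: lambda_system_subset => //.
- exact: cylinders_setI.
- split => //.
  + by split => //; rewrite setTI probability_setT mul1e.
  + move=> U V VU [mU PU] [mV PV]; split; first exact: measurableD.
    rewrite !setDE setIAC -setDE.
    rewrite measureD//=; [|exact: measurableI|]; last first.
      by rewrite ltey_eq fin_num_measure//; exact: measurableI.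
    rewrite (_ : U `&` C `&` V = V `&` C); last first.
      apply/seteqP; split=> w [] => [[? ?]|?] ?; split => //.
      by split => //; exact: VU.
    rewrite PU PV measureD//= ?ltey_eq ?fin_num_measure//.
    rewrite (setIidr VU) muleBl// ?fin_num_measure//.
    by rewrite fin_num_adde_defl// fin_numN fin_num_measure.
  (* Increasing unions: both sides converge by continuity from below, and limits are unique. *)
  + move=> F ndF HF; split.
      by apply: bigcupT_measurable => n; case: (HF n).
    have mF n : measurable (F n) by case: (HF n).
    have cvgFC : P (F n `&` C) @[n --> \oo] --> P ((\bigcup_n F n) `&` C).
      rewrite setI_bigcupl; apply: nondecreasing_cvg_mu.
      * by move=> n; exact: measurableI.
      * by apply: bigcupT_measurable => n; exact: measurableI.
      * by move=> m n mn; apply/subsetPset; apply: setSI; exact/subsetPset/ndF.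
    have cvgF := nondecreasing_cvg_mu mF (bigcupT_measurable _ mF) ndF.
    rewrite -(cvg_lim _ cvgFC)//; apply/cvg_lim => //.
    rewrite (_ : (fun n => P (F n `&` C)) =
        (fun n => P (F n) * P C)%E); last first.
      by apply/funext => n /=; case: (HF n).
    by apply: cvgeZr; [rewrite fin_num_measure|exact: cvgF].
- move=> _ [J [B' [JD' mB' ->]]]; split.
    by apply: fin_bigcap_measurable => // i _; exact: measurable_funPTI.
  have i0J : i0 \notin J by apply/negP => /JD'.
  (* As [i0] lies outside [J], placing [B] there turns the intersection with [C] into a single
     cylinder over [i0] and [J]. *)
  pose B2 i := if i == i0 then B else B' i.
  have B2i0 : B2 i0 = B by rewrite /B2 eqxx.
  have eqJ i : i \in J -> B2 i = B' i.
    by rewrite /B2; case: eqP => // -> ; rewrite (negbTE i0J).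
  have := indX (i0 |` J)%fset _ B2 _.
  rewrite big_fsetU1//= B2i0 -/C => indJ.
  transitivity (P (\bigcap_(i in [set` (i0 |` J)%fset]) X i @^-1` B2 i)).
    congr (P _); apply/seteqP; split=> w /=.
      move=> [Bw Cw] i /=; rewrite in_fset1U => /orP[/eqP->|iJ].
        by rewrite B2i0.
      by rewrite eqJ//; exact: Bw.
    move=> Bw; split.
      move=> i /= iJ; rewrite -eqJ//; apply: Bw.
      by rewrite /= in_fset1U iJ orbT.
    by have := Bw i0; rewrite B2i0; apply; rewrite /= in_fset1U eqxx.
  rewrite indJ.
  + rewrite muleC (indX J)//; last exact: subset_trans D'D.
    congr (_ * _)%E; rewrite big_seq [RHS]big_seq.
    by apply: eq_bigr => i iJ; rewrite eqJ.
  + by move=> i /=; rewrite in_fset1U => /orP[/eqP->//|/JD'/D'D].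
  + by move=> i; rewrite /B2; case: ifP.
Qed.

End independence.

(** * Expectation of a product of independent variables *)

Section product.
Context {disp : measure_display} {T : measurableType disp} {R : realType}.
Variable P : probability T R.

Definition RV_of (X : T -> R) (mX : measurable_fun setT X) : {RV P >-> R} :=
  HB.pack X (isMeasurableFun.Build _ _ _ _ _ mX).

Definition independent2 (X Y : T -> R) : Prop :=
  forall A B : set R, measurable A -> measurable B ->
  P (X @^-1` A `&` Y @^-1` B) = (P (X @^-1` A) * P (Y @^-1` B))%E.

Lemma independent2_comp (X Y : T -> R) (f g : R -> R) :
  measurable_fun setT f -> measurable_fun setT g ->
  independent2 X Y -> independent2 (f \o X) (g \o Y).
Proof.
move=> mf mg XY A B mA mB; apply: (XY (f @^-1` A) (g @^-1` B)).
  by rewrite -[_ @^-1` _]setTI; exact: mf.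
by rewrite -[_ @^-1` _]setTI; exact: mg.
Qed.

(** Both measures agree on rectangles, and these determine the product measure. *)
Lemma independent2_joint (X Y : {RV P >-> R}) (Z : {RV P >-> (R * R)%type}) :
  Z =1 (fun w => (X w, Y w)) -> independent2 X Y ->
  forall C : set (R * R)%type, measurable C ->
  (distribution P X \x distribution P Y)%E C = distribution P Z C.
Proof.
move=> ZE XY; apply: product_measure_unique => A B mA mB.
rewrite /distribution /pushforward /= -XY//; congr (P _).
by apply/seteqP; split=> w /=; rewrite ZE.
Qed.

(** Tonelli's theorem for the joint law, which independence identifies with the product of the two
    laws. *)
Lemma independent2_integralM (X Y : {RV P >-> R}) :
  (forall w, 0 <= X w) -> (forall w, 0 <= Y w) -> independent2 X Y ->
  (\int[P]_w (X w * Y w)%:E = \int[P]_w (X w)%:E * \int[P]_w (Y w)%:E)%E.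
Proof.
move=> X0 Y0 XY.
have mZ : measurable_fun setT (fun w => (X w, Y w)).
  exact/measurable_fun_pair.
pose Z : {RV P >-> (R * R)%type} :=
  HB.pack (fun w => (X w, Y w)) (isMeasurableFun.Build _ _ _ _ _ mZ).
(* The absolute values make [h] nonnegative on the whole plane and change nothing on the values of
   [X] and [Y]. *)
pose h (z : (R * R)%type) : \bar R := (`|z.1| * `|z.2|)%:E.
have mh : measurable_fun [set: (R * R)%type] h.
  apply/measurable_EFinP/measurable_funM.
    by apply: measurableT_comp => //; exact: measurable_fst.
  by apply: measurableT_comp => //; exact: measurable_snd.
have h0 z : (0 <= h z)%E by rewrite lee_fin mulr_ge0.
transitivity (\int[distribution P Z]_z h z)%E.
  rewrite ge0_integral_distribution//; apply: eq_integral => w _ /=.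
  by rewrite /h/= !ger0_norm.
have ZE : Z =1 (fun w => (X w, Y w)) by [].
have joint := independent2_joint ZE XY.
rewrite -(@eq_measure_integral _ _ _ _ _
  (distribution P X \x distribution P Y)%E); last first.
  by move=> A mA _; exact: joint.
rewrite fubini_tonelli1//= /fubini_F /h /=.
have mabs : measurable_fun setT (fun y : R => `|y|%:E).
  exact/measurable_EFinP.
have int_abs (V : {RV P >-> R}) : (forall w, 0 <= V w) ->
    (\int[distribution P V]_y `|y|%:E = \int[P]_w (V w)%:E)%E.
  move=> V0; rewrite ge0_integral_distribution//.
  by apply: eq_integral => w _ /=; rewrite ger0_norm.
under eq_integral.
  move=> x _; under eq_integral do rewrite EFinM.
  rewrite ge0_integralZl; [|by []..|by move=> y _; rewrite lee_fin|];
    last by rewrite lee_fin.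
  rewrite (int_abs _ Y0); over.
rewrite ge0_integralZr//; last by apply: integral_ge0 => w _; rewrite lee_fin.
by rewrite int_abs.
Qed.

(** Fubini's theorem: the inner integral over the law of [X] is a multiple of the mean of [X], hence
    0. This is the source of the martingale property below. *)
Lemma independent2_integral0 (X Y : {RV P >-> R}) :
  P.-integrable setT (EFin \o X) -> P.-integrable setT (EFin \o Y) ->
  (\int[P]_w (X w)%:E = 0)%E -> independent2 X Y ->
  P.-integrable setT (fun w => (X w * Y w)%:E) /\
  (\int[P]_w (X w * Y w)%:E = 0)%E.
Proof.
move=> iX iY X0 XY.
have mZ : measurable_fun setT (fun w => (X w, Y w)).
  exact/measurable_fun_pair.
pose Z : {RV P >-> (R * R)%type} :=
  HB.pack (fun w => (X w, Y w)) (isMeasurableFun.Build _ _ _ _ _ mZ).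
pose h (z : (R * R)%type) : \bar R := (z.1 * z.2)%:E.
have mh : measurable_fun [set: (R * R)%type] h.
  apply/measurable_EFinP/measurable_funM; first exact: measurable_fst.
  exact: measurable_snd.
(* Integrability comes from the nonnegative case applied to the absolute values, whose means are
   finite. *)
have iXY : P.-integrable setT (fun w => (X w * Y w)%:E).
  apply/integrableP; split.
    by apply/measurable_EFinP; exact: measurable_funM.
  have mn (V : {RV P >-> R}) : measurable_fun setT (fun w => `|V w|).
    exact: measurableT_comp.
  pose aX := RV_of (mn X).
  pose aY := RV_of (mn Y).
  have aXY : independent2 aX aY.
    by apply: (@independent2_comp _ _ Num.norm Num.norm).
  rewrite (eq_integral (fun w => (aX w * aY w)%:E)); last first.
    by move=> w _ /=; rewrite normrM.
  have aX0 w : 0 <= aX w by exact: normr_ge0.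
  have aY0 w : 0 <= aY w by exact: normr_ge0.
  rewrite (independent2_integralM aX0 aY0 aXY).
  case/integrableP : iX => _ /= iX; case/integrableP : iY => _ /= iY.
  rewrite lte_mul_pinfty//; first exact: integral_ge0.
  by rewrite ge0_fin_numE//; exact: integral_ge0.
split => //.
transitivity (\int[distribution P Z]_z h z)%E.
  by rewrite integral_distribution.
have ZE : Z =1 (fun w => (X w, Y w)) by [].
have joint := independent2_joint ZE XY.
rewrite -(@eq_measure_integral _ _ _ _ _
  (distribution P X \x distribution P Y)%E); last first.
  by move=> A mA _; exact: joint.
have ih : (distribution P X \x distribution P Y)%E.-integrable setT h.
  apply/integrableP; split => //.
  rewrite (@eq_measure_integral _ _ _ _ (distribution P Z)); last first.
    by move=> A mA _; exact: joint.
  rewrite ge0_integral_distribution//; last by exact: measurableT_comp.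
  by case/integrableP : iXY.
rewrite -integral21_prod_meas1//= /fubini_G /h/=.
under eq_integral.
  move=> y _; under eq_integral do rewrite EFinM.
  rewrite integralZr//; last first.
    by apply: integrable_pushforward.
  rewrite integral_distribution//= X0 mul0e; over.
by rewrite integral0.
Qed.

End product.

(** * Lp norms *)

Section pnorm.
Context {disp : measure_display} {T : measurableType disp} {R : realType}.
Variable P : probability T R.

Import HBNNSimple.

Let pnormE (p : R) (X : T -> R) :
  pnorm P p X = ((\int[P]_w (`|X w| `^ p)%:E) `^ p^-1)%E.
Proof. by rewrite /pnorm unlock. Qed.

Let measurable_norm_powR (X : T -> R) (p : R) : measurable_fun setT X ->
  measurable_fun setT (fun w => `|X w| `^ p).
Proof.
move=> mX; apply: (measurableT_comp (measurable_powR p)) => //.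
exact: measurableT_comp.
Qed.

Lemma pnorm0 (p : R) : 0 < p -> pnorm P p (cst 0) = 0%E.
Proof. by move=> p0; rewrite /pnorm Lnorm0// eqe gt_eqF. Qed.

Lemma pnormZ (p a : R) (X : T -> R) : 0 < p -> measurable_fun setT X ->
  pnorm P p (fun w => a * X w) = (`|a|%:E * pnorm P p X)%E.
Proof.
move=> p0 mX; rewrite !pnormE.
under eq_integral do rewrite normrM powRM// EFinM.
rewrite ge0_integralZl; last 4 first.
- by [].
- by apply/measurable_EFinP; exact: measurable_norm_powR.
- by move=> w _; rewrite lee_fin powR_ge0.
- by rewrite lee_fin powR_ge0.
rewrite poweRM//; last by apply: integral_ge0 => w _; rewrite lee_fin powR_ge0.
by rewrite poweR_EFin -powRrM divff ?gt_eqF// powRr1.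
Qed.

(** The p-th powers of the absolute values are again independent, so the integral of their product
    factors. *)
Lemma pnormM (p : R) (X Y : {RV P >-> R}) : independent2 P X Y ->
  pnorm P p (fun w => X w * Y w) = (pnorm P p X * pnorm P p Y)%E.
Proof.
move=> XY; rewrite !pnormE.
have mpow (V : {RV P >-> R}) : measurable_fun setT (fun w => `|V w| `^ p).
  exact: measurable_norm_powR.
pose aX := RV_of P (mpow X).
pose aY := RV_of P (mpow Y).
have mnp : measurable_fun setT (fun x : R => `|x| `^ p).
  by apply: (measurableT_comp (measurable_powR p)).
have aXY : independent2 P aX aY := independent2_comp mnp mnp XY.
have aX0 w : 0 <= aX w by exact: powR_ge0.
have aY0 w : 0 <= aY w by exact: powR_ge0.
rewrite (eq_integral (fun w => (aX w * aY w)%:E)); last first.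
  by move=> w _ /=; rewrite normrM powRM.
rewrite (independent2_integralM aX0 aY0 aXY) poweRM//.
  by apply: integral_ge0 => w _; rewrite lee_fin.
by apply: integral_ge0 => w _; rewrite lee_fin.
Qed.

Lemma pnorm_integrable (p : R) (X : T -> R) : 1 <= p ->
  measurable_fun setT X -> (pnorm P p X < +oo)%E ->
  P.-integrable setT (EFin \o X).
Proof.
move=> p1 mX Xoo; apply/Lfun1_integrable.
have PT : P setT \is a fin_num by rewrite fin_num_measure.
have p1' : (1 <= p%:E)%E by rewrite lee_fin.
apply: (Lfun_subset (lexx 1%E) p1' PT p1').
by rewrite inE; apply/andP; split; rewrite inE.
Qed.

(* [f] need not be measurable: every simple function below [f] is almost
   everywhere below [g]. *)
Lemma ge0_le_integral_ae (f g : T -> \bar R) :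
  (forall w, (0 <= f w)%E) -> (forall w, (0 <= g w)%E) ->
  measurable_fun setT g -> {ae P, forall w, (f w <= g w)%E} ->
  (\int[P]_w f w <= \int[P]_w g w)%E.
Proof.
move=> f0 g0 mg fg; rewrite ge0_integralTE//.
apply: ge_ereal_sup => _ [h hf <-].
rewrite -integralT_nnsfun; apply: ae_ge0_le_integral => //.
- by move=> w _; rewrite lee_fin; exact: fun_ge0.
- exact/measurable_EFinP.
- by apply: filterS fg => w fgw _; exact: le_trans (hf w) fgw.
Qed.

(** Fatou's lemma for the p-th powers of the absolute values. *)
Lemma pnorm_lim (p : R) (V : nat -> T -> R) (C : \bar R) : 0 < p ->
  (forall k, measurable_fun setT (V k)) ->
  {ae P, forall w, cvgn (fun k => V k w)} ->
  (forall k, (pnorm P p (V k) <= C)%E) ->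
  (pnorm P p (fun w => limn (fun k => V k w)) <= C)%E.
Proof.
move=> p0 mV cvgV VC.
have pN0 : p != 0 by rewrite gt_eqF.
have C0 : (0 <= C)%E by apply: le_trans (VC 0%N); exact: Lnorm_ge0.
pose u k w := (`|V k w| `^ p)%:E.
have mu k : measurable_fun setT (u k).
  by apply/measurable_EFinP; exact: measurable_norm_powR.
have u0 k w : (0 <= u k w)%E by rewrite lee_fin powR_ge0.
have ucvg : {ae P, forall w,
    ((`|limn (fun k => V k w)| `^ p)%:E <= limn_einf (u ^~ w))%E}.
  apply: filterS cvgV => w cvgVw; set x := limn _.
  (* Continuity of the power is derived from its derivative at a positive point; for limit 0 the
     bound is the nonnegativity of the lower limit. *)
  have [->|x0] := eqVneq x 0.
    rewrite normr0 powR0// limn_einf_lim; apply: lime_ge.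
      exact: is_cvg_einfs.
    by apply: nearW => n; apply: le_ereal_inf_tmp => _ [k /= _ <-].
  have Vx : `|V k w| @[k --> \oo] --> `|x| by apply: cvg_norm; exact: cvgVw.
  have ux : u k w @[k --> \oo] --> (`|x| `^ p)%:E.
    have cp : {for `|x|, continuous (fun y : R => y `^ p)}.
      apply/differentiable_continuous/derivable1_diffP.
      have := @is_derive1_powR R p `|x|; rewrite normr_gt0 => /(_ x0) dp.
      exact: ex_derive.
    apply: cvg_EFin; first exact: nearW.
    exact: (continuous_cvg _ cp Vx).
  by rewrite (cvg_limn_einf_sup ux).1.
rewrite pnormE.
have : (\int[P]_w (`|limn (fun k => V k w)| `^ p)%:E <= C `^ p)%E.
  apply: (@le_trans _ _ (\int[P]_w limn_einf (u ^~ w)))%E.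
    apply: ge0_le_integral_ae => //.
    - move=> w; rewrite limn_einf_lim; apply: lime_ge.
        exact: is_cvg_einfs.
      by apply: nearW => n; apply: le_ereal_inf_tmp => _ [k /= _ <-].
    - apply: (emeasurable_fun_cvg (fun n w => einfs (u ^~ w) n)).
        by move=> n; exact: measurable_fun_einfs.
      by move=> w _; rewrite limn_einf_lim; exact: is_cvg_einfs.
  apply: le_trans (fatou _ _ mu _) _ => //.
  rewrite limn_einf_lim; apply: lime_le; first exact: is_cvg_einfs.
  (* The infimum over the tail from [n] is at most its term at [n], which the hypothesis bounds by
     the p-th power of [C]. *)
  apply: nearW => n; apply: le_trans (ereal_inf_lbound _) _.
    by exists n => //=.
  rewrite -[leLHS]poweRe1; last by apply: integral_ge0.
  rewrite -(mulVf pN0) poweRrM gt0_ler_poweR//.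
  - exact: ltW.
  - by rewrite in_itv/= leey poweR_ge0.
  - by rewrite in_itv/= leey C0.
  - by have := VC n; rewrite pnormE.
move=> h; have -> : C = ((C `^ p) `^ p^-1)%E.
  by rewrite -poweRrM divff// poweRe1.
rewrite gt0_ler_poweR//.
- by rewrite invr_ge0 ltW.
- by rewrite in_itv/= leey integral_ge0// => w _; rewrite lee_fin powR_ge0.
- by rewrite in_itv/= leey poweR_ge0.
Qed.

End pnorm.

(** * Homogeneous polynomials *)

Section enumeration.

(** Enumerates by the smallest entry, so that recursion on the degree is the splitting of a
    polynomial along its smallest index. *)
Fixpoint Iset_enum (d n N : nat) : seq (d.-tuple nat) :=
  match d with
  | 0 => [:: [tuple]]
  | d'.+1 => [seq cons_tuple i J | i <- index_iota n N.+1,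
                                   J <- Iset_enum d' i.+1 N]
  end.

Lemma cons_tuple_inj (d : nat) (S : Type) (i j : S) (I J : d.-tuple S) :
  cons_tuple i I = cons_tuple j J -> i = j /\ I = J.
Proof. by move=> /(congr1 val)/= [-> IJ]; split => //; exact/val_inj. Qed.

Lemma Iset_enum_uniq d n N : uniq (Iset_enum d n N).
Proof.
elim: d n => [|d IH] n //=.
apply: allpairs_uniq_dep => //; first exact: iota_uniq.
move=> [i I1] [j I2] _ _ /= ij.
by have [-> ->] := cons_tuple_inj ij.
Qed.

Lemma mem_Iset_enum d n N (I : d.-tuple nat) :
  (I \in Iset_enum d n N) = sorted ltn I && all (in_range n (Some N)) I.
Proof.
elim: d n I => [|d IH] n I /=; first by rewrite (tuple0 I) inE.
case/tupleP: I => i I.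
have -> : (cons_tuple i I \in
      [seq cons_tuple i J | i <- index_iota n N.+1, J <- Iset_enum d i.+1 N]) =
    (n <= i < N.+1)%N && (I \in Iset_enum d i.+1 N).
  apply/allpairsPdep/andP => [[j [J [jn JI]]]|[iN II]].
    move=> iIjJ; have [-> ->] := cons_tuple_inj iIjJ.
    by rewrite -mem_index_iota.
  by exists i, I; rewrite mem_index_iota.
rewrite IH /= (path_sortedE ltn_trans) ltnS.
case: (boolP (sorted ltn I)) => sI; rewrite ?andbF//= andbT.
case: (boolP (in_range n (Some N) i)) => //= [/andP[ni iN]|]; last first.
  by rewrite /in_range => /negbTE ->; rewrite andbF.
rewrite ni iN/=; elim: (tval I) => //= j s ->.
(* Since [n <= i], an entry above [i] meets the lower bound [n] automatically. *)
rewrite /in_range; case: (ltnP i j) => ij; rewrite ?andbF//=.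
by rewrite (leq_trans ni (ltnW ij))/=; case: (j <= N)%N; rewrite ?andbF.
Qed.

Lemma Iset_enumE d n N : [set` Iset_enum d n N] = @Iset n (Some N) d.
Proof.
by apply/seteqP; split=> I /=; rewrite mem_Iset_enum => /andP.
Qed.

Lemma Iset_enum_sum (S : pzSemiRingType) d n N (F : d.+1.-tuple nat -> S) :
  \sum_(I <- Iset_enum d.+1 n N) F I =
  \sum_(n <= i < N.+1) \sum_(I <- Iset_enum d i.+1 N) F (cons_tuple i I).
Proof. by rewrite big_allpairs_dep. Qed.

End enumeration.

Section sumsq.
Context {R : realType}.

Definition sumsq d n N (b : coefs R d) : R :=
  \sum_(I <- Iset_enum d n N) b I ^+ 2.

Lemma sumsq_ge0 d n N (b : coefs R d) : 0 <= sumsq n N b.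
Proof. by apply: sumr_ge0 => I _; exact: sqr_ge0. Qed.

Lemma sumsqS d n N (b : coefs R d.+1) :
  sumsq n N b = \sum_(n <= i < N.+1) sumsq i.+1 N (fun I => b (cons_tuple i I)).
Proof. exact: Iset_enum_sum. Qed.

(** A finite partial sum of the squares stays below their total. The level [k] covers finite [N] as
    well as all truncations of an infinite range. *)
Lemma sumsq_le1 d n (N : option nat) k (b : coefs R d) :
  (if N is Some N' then (k <= N')%N else true) ->
  unit_coefs n N b -> sumsq n k b <= 1.
Proof.
move=> kN; rewrite /unit_coefs /= -lee_fin => <-.
apply: esum_ge; exists [set` Iset_enum d n k].
  split; first exact: finite_seq.
  rewrite Iset_enumE => I [sI /allP aI]; split => //.
  apply/allP => i /aI /andP[ni ik]; rewrite /in_range ni /=.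
  by case: N kN => // N' kN; exact: leq_trans kN.
by rewrite -fsbig_seq ?Iset_enum_uniq// sumEFin.
Qed.

End sumsq.

Section polynomial.
Context {disp : measure_display} {T : measurableType disp} {R : realType}.
Variable P : probability T R.

Lemma polyV_finE d (xi : nat -> 'I_d -> {RV P >-> R}) n N b w :
  polyV_fin xi n N b w =
  \sum_(I <- Iset_enum d n N) (b I * \prod_(m < d) xi (tnth I m) m w).
Proof. by rewrite /polyV_fin -Iset_enumE -fsbig_seq ?Iset_enum_uniq. Qed.

Lemma polyV_fin0 (xi : nat -> 'I_0 -> {RV P >-> R}) n N b w :
  polyV_fin xi n N b w = b [tuple].
Proof. by rewrite polyV_finE big_seq1 big_ord0 mulr1. Qed.

Lemma polyV_finS d (xi : nat -> 'I_d.+1 -> {RV P >-> R}) n N b w :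
  polyV_fin xi n N b w = \sum_(n <= i < N.+1) xi i ord0 w *
    polyV_fin (fun j m => xi j (lift ord0 m)) i.+1 N
      (fun I => b (cons_tuple i I)) w.
Proof.
rewrite polyV_finE Iset_enum_sum; apply: eq_bigr => i _.
rewrite polyV_finE mulr_sumr; apply: eq_bigr => I _.
rewrite big_ord_recl mulrCA; congr (_ * (_ * _)).
by apply: eq_bigr => m _; rewrite tnthS.
Qed.

(** If the l2 norm is 0, all coefficients vanish, so the identity survives the convention that
    dividing by 0 gives 0. *)
Lemma polyV_fin_scale d (xi : nat -> 'I_d -> {RV P >-> R}) n N b w :
  polyV_fin xi n N b w = Num.sqrt (sumsq n N b) *
    polyV_fin xi n N (fun I => b I / Num.sqrt (sumsq n N b)) w.
Proof.
have [s0|s0] := eqVneq (Num.sqrt (sumsq n N b)) 0; last first.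
  rewrite !polyV_finE mulr_sumr; apply: eq_bigr => I _.
  by rewrite mulrA mulrCA divff// mulr1.
have {}s0 : sumsq n N b = 0.
  by apply/eqP; rewrite eq_le sumsq_ge0 andbT -sqrtr_eq0 s0.
rewrite s0 sqrtr0 mul0r polyV_finE big_seq big1// => I II.
suff -> : b I = 0 by rewrite mul0r.
apply/eqP; rewrite -sqrf_eq0; move/eqP: s0; rewrite psumr_eq0; last first.
  by move=> J _; exact: sqr_ge0.
by move=> /allP/(_ I II).
Qed.

Lemma sumsq_normalized d n N (b : coefs R d) :
  sumsq n N (fun I => b I / Num.sqrt (sumsq n N b)) <= 1.
Proof.
rewrite {1}/sumsq; under eq_bigr do rewrite exprMn.
rewrite -mulr_suml exprVn sqr_sqrtr ?sumsq_ge0// -/(sumsq n N b).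
have [->|s0] := eqVneq (sumsq n N b) 0; first by rewrite mul0r.
by rewrite divff.
Qed.

(** Gives access to the closure of measurable functions under sums and products. *)
Lemma measurable_wrtP (G : set (set T)) (X : T -> R) :
  measurable_wrt <<s G>> X <->
  measurable_fun setT (X : g_sigma_algebraType G -> R).
Proof.
split=> [mX _ B mB|mX B mB]; first by rewrite setTI; exact: mX.
by rewrite -[_ @^-1` _]setTI; exact: mX.
Qed.

Lemma measurable_wrt_polyV_fin (G : set (set T)) d
    (xi : nat -> 'I_d -> {RV P >-> R}) n N b :
  (forall i m, (n <= i <= N)%N -> measurable_wrt <<s G>> (xi i m)) ->
  measurable_wrt <<s G>> (polyV_fin xi n N b).
Proof.
elim: d n xi b => [|d IH] n xi b mxi; apply/measurable_wrtP.
  rewrite (_ : polyV_fin _ _ _ _ = cst (b [tuple])).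
    exact: measurable_cst.
  by apply/funext => w; rewrite polyV_fin0.
(* The test holds for every index of the sum; it keeps the range condition at hand when the summands
   are treated one by one. *)
rewrite (_ : polyV_fin _ _ _ _ = (fun w => \sum_(i <- index_iota n N.+1)
    if (n <= i <= N)%N then xi i ord0 w *
    polyV_fin (fun j m => xi j (lift ord0 m)) i.+1 N
      (fun I => b (cons_tuple i I)) w else 0)); last first.
  apply/funext => w; rewrite polyV_finS big_seq [RHS]big_seq.
  by apply: eq_bigr => i; rewrite mem_index_iota ltnS => ->.
apply: measurable_sum => i; case: (boolP (n <= i <= N)%N) => [iN|_];
  last exact: measurable_cst.
apply: measurable_funM; first by apply/measurable_wrtP; exact: mxi.
apply/measurable_wrtP; apply: IH => j m /andP[ij jN].
apply: mxi; rewrite jN andbT.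
by case/andP: iN => ni _; exact: leq_trans ni (ltnW ij).
Qed.

Lemma measurable_polyV_fin d (xi : nat -> 'I_d -> {RV P >-> R}) n N b :
  measurable_fun setT (polyV_fin xi n N b).
Proof.
move=> _ B mB; rewrite setTI.
have := @measurable_wrt_polyV_fin (@measurable _ T) d xi n N b.
rewrite (sigma_algebra_id (sigma_algebra_measurable T)); apply=> // i m _ C mC.
exact: measurable_funPTI.
Qed.

End polynomial.

(** * The constants *)

Section zeta.
Context {R : realType}.
Local Open Scope ereal_scope.
Implicit Types (kI kM x : \bar R) (v : seq (\bar R)).

Lemma zeta_rec_cons kI kM x v : v != [::] ->
  zeta_rec kI kM (x :: v) = kM * zeta_rec kI kM v * x.
Proof. by case: v. Qed.

Lemma zeta_rec_gt0 kI kM v : 0 < kI -> 0 < kM -> (forall x, x \in v -> 0 < x) ->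
  0 < zeta_rec kI kM v.
Proof.
move=> kI0 kM0; elim: v => [|x v IH] v0 //.
have x0 : 0 < x by apply: v0; rewrite mem_head.
have [->|vN0] := eqVneq v [::]; first by rewrite /= mule_gt0.
rewrite zeta_rec_cons// !mule_gt0// IH// => y yv.
by apply: v0; rewrite inE yv orbT.
Qed.

End zeta.

Section best_constant.
Context {disp : measure_display} {T : measurableType disp} {R : realType}.
Variable P : probability T R.
Variable C : nat -> (nat -> {RV P >-> R}) -> Prop.
Local Open Scope ereal_scope.

Lemma le_nnsup (A : set (\bar R)) x : A x -> x <= nnsup A.
Proof. by move=> Ax; apply: ereal_sup_ubound; left. Qed.

Lemma nnsup_ge0 (A : set (\bar R)) : 0 <= nnsup A.
Proof. by apply: ereal_sup_ubound; right. Qed.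

Lemma ge_nnsup (A : set (\bar R)) x : 0 <= x -> (forall y, A y -> y <= x) ->
  nnsup A <= x.
Proof. by move=> x0 Ax; apply: ge_ereal_sup => y [/Ax//|->]. Qed.

Lemma best_constant_ge0 p : 0 <= best_constant C p.
Proof. by apply: le_ereal_inf_tmp => _ [K [K0 _] <-]; rewrite lee_fin. Qed.

(** The one-term sum with coefficient 1 forces [K >= 1], as its norm can be cancelled. *)
Lemma best_constant_ge1 p theta : C 1 theta ->
  0 < pnorm P p (theta 0%N) < +oo -> 1 <= best_constant C p.
Proof.
move=> Ctheta /andP[t0 too]; apply: le_ereal_inf_tmp => _ [K [K0 hK] <-].
have := hK 1%N theta (fun=> 1%R) Ctheta.
rewrite big_ord1 expr1n => /(_ erefl).
rewrite (_ : (fun w => _) = theta 0%N); last first.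
  by apply/funext => w; rewrite big_ord1 mul1r.
move=> h; rewrite -(@lee_pmul2r _ (pnorm P p (theta 0%N))) ?mul1e//; last first.
  by rewrite ge0_fin_numE// ltW.
apply: le_trans h _; apply: lee_wpmul2l; first by rewrite lee_fin.
apply: ge_nnsup; first exact: ltW.
by move=> _ [[|//] _ <-].
Qed.

(** Homogeneous form of the defining inequality: rescaling removes the normalization of [b], and a
    bound valid for every admissible [K] passes to the infimum. *)
Lemma best_constant_le p n theta (b : nat -> R) (S : R) : (0 < p)%R ->
  best_constant C p < +oo -> C n theta -> (0 <= S)%R ->
  (forall i, (i < n)%N -> pnorm P p (theta i) <= S%:E) ->
  pnorm P p (fun w => (\sum_(i < n) b i * theta i w)%R) <=
  best_constant C p * (S * Num.sqrt (\sum_(i < n) b i ^+ 2))%:E.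
Proof.
move=> p0 Coo Cth S0 thS; set s := Num.sqrt _.
have [s0|s0] := eqVneq s 0%R.
  rewrite (_ : (fun w => _) = cst 0%R); last first.
    apply/funext => w; apply: big1 => i _.
    suff -> : b i = 0%R by rewrite mul0r.
    move/eqP : s0; rewrite sqrtr_eq0 => sle0.
    have /eqP : (\sum_(i < n) b i ^+ 2 = 0)%R.
      by apply/eqP; rewrite eq_le sle0 sumr_ge0// => j _; exact: sqr_ge0.
    rewrite psumr_eq0; last by move=> j _; exact: sqr_ge0.
    by move=> /allP/(_ i (mem_index_enum _)) /=; rewrite sqrf_eq0 => /eqP.
  by rewrite pnorm0// mule_ge0 ?best_constant_ge0// lee_fin s0 mulr0.
have sp : (0 < s)%R by rewrite lt_def s0 sqrtr_ge0.
rewrite (_ : (fun w => _) =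
    (fun w => s * \sum_(i < n) (b i / s) * theta i w)%R); last first.
  apply/funext => w; rewrite mulr_sumr; apply: eq_bigr => i _.
  by rewrite mulrA mulrCA divff// mulr1.
rewrite pnormZ//; last first.
  by apply: measurable_sum => i; apply: measurable_funM.
rewrite gtr0_norm// mulrC EFinM muleCA lee_pmul2l//.
have b1 : (\sum_(i < n) (b i / s) ^+ 2 = 1)%R.
  under eq_bigr do rewrite exprMn.
  rewrite -mulr_suml exprVn sqr_sqrtr; last first.
    by apply: sumr_ge0 => i _; exact: sqr_ge0.
  rewrite divff//; apply/eqP => s00; move: s0; rewrite /s s00 sqrtr0 eqxx//.
set A := pnorm _ _ _.
have AK K : (0 <= K)%R -> (forall n theta (b : nat -> R), C n theta ->
    (\sum_(i < n) b i ^+ 2 = 1)%R ->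
    pnorm P p (fun w => (\sum_(i < n) b i * theta i w)%R) <=
    K%:E * nnsup [set pnorm P p (theta i) | i in [set i | (i < n)%N]]) ->
    A <= K%:E * S%:E.
  move=> K0 hK; apply: le_trans (hK n theta (fun i => b i / s)%R Cth b1) _.
  apply: lee_wpmul2l; first by rewrite lee_fin.
  apply: ge_nnsup; first by rewrite lee_fin.
  by move=> _ [i /= iN <-]; exact: thS.
have Cfin : best_constant C p \is a fin_num.
  by rewrite ge0_fin_numE// best_constant_ge0.
(* Passing to the infimum divides by [S]. For [S = 0] one admissible [K], which exists by
   finiteness, already gives the bound 0. *)
have [S00|SN0] := eqVneq S 0%R.
  have [_ [K [K0 hK] <-] _] := ereal_inf_lt Coo.
  by have := AK K K0 hK; rewrite S00 !mule0.
have Sp : (0 < S)%R by rewrite lt_def SN0.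
rewrite -lee_pdivrMr//; apply: le_ereal_inf_tmp => _ [K [K0 hK] <-].
by rewrite lee_pdivrMr//; exact: AK.
Qed.

End best_constant.

(** * Reversed martingale differences *)

Section martingale.
Context {disp : measure_display} {T : measurableType disp} {R : realType}.
Variable P : probability T R.

Lemma independent2_sigma (I : choiceType) (D D' : set I)
    (X : I -> {RV P >-> R}) (i0 : I) (Y : T -> R) :
  independent_RVs D X -> D' `<=` D -> D i0 -> ~ D' i0 ->
  measurable_wrt <<s generators D' X>> Y -> independent2 P (X i0) Y.
Proof.
move=> indX D'D Di0 D'i0 mY A B mA mB; rewrite setIC muleC.
exact: (independent_sigma indX D'D Di0 D'i0 (mY _ mB) mA).
Qed.

Lemma generators_sub (I : choiceType) (D D' : set I) (X : I -> {RV P >-> R}) :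
  D' `<=` D -> <<s generators D' X>> `<=` <<s generators D X>>.
Proof.
move=> D'D; apply: sub_sigma_algebra2 => _ [i [B [D'i mB ->]]].
by exists i, B; split => //; exact: D'D.
Qed.

Lemma measurable_wrt_generator (I : choiceType) (D : set I)
    (X : I -> {RV P >-> R}) i :
  D i -> measurable_wrt <<s generators D X>> (X i).
Proof. by move=> Di B mB; apply: sub_sigma_algebra; exists i, B. Qed.

(** The factor with first index [N - k] is centered and independent of everything with larger first
    index, thus of [W (N - k)] and of the past before time [k]. *)
Lemma reversed_martingale_differences d (xi : nat -> 'I_d.+1 -> {RV P >-> R})
    (n N : nat) (W : nat -> {RV P >-> R}) (theta : nat -> {RV P >-> R}) :
  let X im := xi im.1 im.2 in
  independent_RVs [set im | (n <= im.1 <= N)%N] X ->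
  (forall i, (n <= i <= N)%N -> centered P (xi i ord0)) ->
  (forall i, (n <= i <= N)%N ->
    measurable_wrt <<s generators [set im | (i < im.1 <= N)%N] X>> (W i)) ->
  (forall i, (n <= i <= N)%N -> P.-integrable setT (EFin \o W i)) ->
  (forall k w, theta k w = xi (N - k)%N ord0 w * W (N - k)%N w) ->
  centered_martingale_differences (N.+1 - n) theta.
Proof.
move=> X indX cX mW iW thetaE.
have inN k : (k < N.+1 - n)%N -> (n <= N - k <= N)%N.
  by move=> kN; rewrite leq_subr andbT; lia.
(* Time [k] knows the rows from [N - k] on. The range condition keeps [D k] inside the independent
   family even when [N - k] drops below [n]. *)
pose D k := [set im : nat * 'I_d.+1 | (n <= im.1 <= N)%N /\ (N - k <= im.1)%N].
pose F k := <<s generators (D k) X>>.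
(* One computation for two purposes: [A = setT] gives centering, and [A] in the preceding
   sigma-algebra gives conditional expectation 0. *)
have prod0 k (A : set T) : (k < N.+1 - n)%N -> measurable_wrt
    <<s generators [set im | (N - k < im.1 <= N)%N] X>> (\1_A : T -> R) ->
    P.-integrable setT
      (fun w => (xi (N - k)%N ord0 w * (\1_A w * W (N - k)%N w))%:E) /\
    (\int[P]_w (xi (N - k)%N ord0 w * (\1_A w * W (N - k)%N w))%:E = 0)%E.
  move=> kN mA; set i := (N - k)%N; have iN : (n <= i <= N)%N := inN _ kN.
  have mY : measurable_wrt <<s generators [set im | (i < im.1 <= N)%N] X>>
      (fun w => \1_A w * W i w).
    apply/measurable_wrtP/measurable_funM; first exact/measurable_wrtP.
    by apply/measurable_wrtP; exact: mW.
  have mY' : measurable_fun setT (fun w => \1_A w * W i w).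
    move=> _ B mB; rewrite setTI.
    by apply: (@sigma_generators_measurable _ _ _ P _ _ X); exact: mY.
  have [iX X0] := cX i iN.
  apply: (@independent2_integral0 _ _ _ P (xi i ord0) (RV_of P mY')) => //.
  - apply: le_integrable (iW _ iN) => //; first exact/measurable_EFinP.
    move=> w _ /=; rewrite lee_fin normrM ler_piMl//.
    by rewrite indicE ger0_norm// lern1 leq_b1.
  - by move: X0; rewrite unlock.
  - apply: (@independent2_sigma _ [set im | (n <= im.1 <= N)%N]
      [set im | (i < im.1 <= N)%N] X (i, ord0)) => //=.
    + by move=> [j m] /= /andP[ij ->]; rewrite andbT; lia.
    + by rewrite ltnn.
exists F; split.
- split.
  + by move=> k; exact: smallest_sigma_algebra.
  + by move=> k; exact: sigma_generators_measurable.
  + move=> i j ij; apply: generators_sub => -[l m] [/= lN Nl].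
    by split => //=; lia.
- move=> k kN; rewrite (_ : theta k =
      (fun w => xi (N - k)%N ord0 w * W (N - k)%N w) :> (T -> R)); last first.
    by apply/funext => w; rewrite thetaE.
  apply/measurable_wrtP/measurable_funM; apply/measurable_wrtP.
    apply: (@measurable_wrt_generator _ (D k) X ((N - k)%N, ord0)).
    by split => //=; exact: inN.
  move=> B mB; have := mW _ (inN _ kN) B mB; apply: generators_sub.
  by move=> [l m] /= lN; split => /=; have := inN _ kN; lia.
- move=> k kN; have [] := prod0 k setT kN.
    by apply/measurable_wrtP; rewrite indicT; exact: measurable_cst.
  under [X in integrable _ _ X -> _]eq_fun do rewrite indicT mul1r -thetaE.
  move=> iT; under eq_integral do rewrite indicT mul1r -thetaE.
  by move=> T0; split => //; rewrite unlock.
- move=> k kN; split.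
  + by apply/measurable_wrtP; exact: measurable_cst.
  + exact: finite_measure_integrable_cst.
  + move=> A FA; rewrite integral0.
    (* As [k < N] here, the rows from [N - k] on are exactly those above [N - k.+1]. *)
    have [|_] := prod0 k.+1 A kN.
      apply/measurable_wrtP; apply: measurable_indic.
      move: FA; apply: generators_sub => -[l m] [/= lN Nl]; lia.
    move=> <-; rewrite [RHS]integral_mkcond; apply: eq_integral => w _.
    rewrite patchE thetaE indicE; case: ifPn => wA; first by rewrite mul1r.
    by rewrite mul0r mulr0.
Qed.

End martingale.

(** * The moment inequality *)

Section moment_inequality.

Let itv_tail (n i j N : nat) :
  (n <= i <= N)%N -> (i < j <= N)%N -> (n <= j <= N)%N.
Proof.
by move=> /andP[ni _] /andP[ij ->]; rewrite (leq_trans ni (ltnW ij)).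
Qed.

Let itv_rev (n N k : nat) : (k < N.+1 - n)%N -> (n <= N - k <= N)%N.
Proof. by move=> kN; lia. Qed.

Let itv_shift (n N k : nat) : (k < N.+1 - n)%N -> (n <= k + n <= N)%N.
Proof. by move=> kN; lia. Qed.

Context {disp : measure_display} {T : measurableType disp} {R : realType}.
Variable P : probability T R.

(** The real bounds [c m] stand in for the suprema [nu]: they stay valid when the index range
    shrinks, so the induction hypothesis gives one constant for all inner polynomials. *)
Lemma polyV_fin_pnorm (p : R) d (xi : nat -> 'I_d.+1 -> {RV P >-> R})
    (c : 'I_d.+1 -> R) (n N : nat) (b : coefs R d.+1) :
  1 <= p -> (0 < KI P p)%E -> (0 < KM P p)%E ->
  independent_RVs [set im | (n <= im.1 <= N)%N] (fun im => xi im.1 im.2) ->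
  (forall i m, (n <= i <= N)%N -> centered P (xi i m)) ->
  (forall m, 0 < c m) ->
  (forall i m, (n <= i <= N)%N -> (pnorm P p (xi i m) <= (c m)%:E)%E) ->
  let z := zeta_rec (KI P p) (KM P p) [seq (c m)%:E | m <- enum 'I_d.+1] in
  (z < +oo)%E ->
  (pnorm P p (polyV_fin xi n N b) <= z * (Num.sqrt (sumsq n N b))%:E)%E.
Proof.
move=> p1 KI0 KM0; have p0 : 0 < p by exact: lt_le_trans p1.
elim: d xi c n b => [|d IH] xi c n b indX cX c0 Xc z.
  rewrite /z enum_ordSl enum_ord0/= => zoo.
  (* A finite product of positive factors has finite factors; the same argument recurs in the
     induction step. *)
  have KIoo : (KI P p < +oo)%E.
    rewrite ltey; apply/eqP => KIoo; move: zoo.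
    by rewrite KIoo gt0_mulye ?lte_fin// ltxx.
  pose theta k := xi (k + n)%N ord0.
  pose b' k := b (cons_tuple (k + n)%N [tuple]).
  rewrite (_ : polyV_fin _ _ _ _ =
      (fun w => \sum_(k < N.+1 - n) b' k * theta k w)); last first.
    apply/funext => w; rewrite polyV_finS -{1}[n]add0n big_addn big_mkord.
    by apply: eq_bigr => k _; rewrite polyV_fin0 mulrC.
  rewrite (_ : sumsq n N b = \sum_(k < N.+1 - n) b' k ^+ 2); last first.
    rewrite sumsqS -{1}[n]add0n big_addn big_mkord.
    by apply: eq_bigr => k _; rewrite /sumsq big_seq1.
  rewrite -muleA -EFinM; apply: best_constant_le => //.
  - split.
      apply: (@independent_RVs_reindex _ _ _ P _ _ _ _ _
        (fun k => ((k + n)%N, ord0)) (fun im => (im.1 - n)%N) _ _ indX) => /=.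
        by move=> k _; rewrite addnK.
      by move=> k /= /itv_shift.
    by move=> k kN; exact/cX/itv_shift.
  - exact/ltW/c0.
  - by move=> k kN; exact/Xc/itv_shift.
pose v := [seq (c (lift ord0 m))%:E | m <- enum 'I_d.+1].
pose z' := zeta_rec (KI P p) (KM P p) v.
rewrite {}/z; have -> : [seq (c m)%:E | m <- enum 'I_d.+2] = (c ord0)%:E :: v.
  by rewrite enum_ordSl map_cons -map_comp.
have vN0 : v != [::] by rewrite /v enum_ordSl.
rewrite zeta_rec_cons// -/z' => zoo.
have z'0 : (0 < z')%E.
  by apply: zeta_rec_gt0 => // _ /mapP[m _ ->]; rewrite lte_fin c0.
have KMoo : (KM P p < +oo)%E.
  rewrite ltey; apply/eqP => KMoo; move: zoo.
  by rewrite KMoo gt0_mulye// gt0_mulye ?lte_fin// ltxx.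
have z'oo : (z' < +oo)%E.
  rewrite ltey; apply/eqP => z'oo; move: zoo.
  by rewrite z'oo gt0_muley// gt0_mulye ?lte_fin// ltxx.
have [z z'E] : exists z, z' = z%:E.
  by exists (fine z'); rewrite fineK// ge0_fin_numE// ltW.
have z0 : 0 < z by rewrite -lte_fin -z'E.
pose xi' j m := xi j (lift ord0 m).
pose bc i : coefs R d.+1 := fun I => b (cons_tuple i I).
(* The l2 norms [B i] become the coefficients of the martingale sum, and the normalized polynomials
   [W i] share one bound. *)
pose B i := Num.sqrt (sumsq i.+1 N (bc i)).
have mW i := @measurable_polyV_fin _ _ _ P _ xi' i.+1 N (fun I => bc i I / B i).
pose W i := RV_of P (mW i).
have mt k : measurable_fun setT (fun w => xi (N - k)%N ord0 w * W (N - k)%N w).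
  exact: measurable_funM.
pose theta k := RV_of P (mt k).
have WE i w : polyV_fin xi' i.+1 N (bc i) w = B i * W i w.
  exact: polyV_fin_scale.
have ind' i : (n <= i <= N)%N ->
    independent_RVs [set im | (i.+1 <= im.1 <= N)%N] (fun im => xi' im.1 im.2).
  (* The first column is dropped; the default [ord0] of the left inverse is never met on shifted
     columns. *)
  move=> iN; apply: (@independent_RVs_reindex _ _ _ P _ _ _ _ _
    (fun jm => (jm.1, lift ord0 jm.2))
    (fun jm => (jm.1, odflt ord0 (unlift ord0 jm.2))) _ _ indX) => /=.
    by move=> [j m] _ /=; rewrite liftK.
  by move=> [j m] /= /(itv_tail iN).
have W_le i : (n <= i <= N)%N -> (pnorm P p (W i) <= z%:E)%E.
  move=> iN; apply: (@le_trans _ _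
    (z' * (Num.sqrt (sumsq i.+1 N (fun I => (bc i I / B i)%R)))%:E)%E).
    apply: (IH xi' (fun m => c (lift ord0 m))) => //.
    - exact: ind'.
    - by move=> j m /(itv_tail iN); exact: cX.
    - by move=> j m /(itv_tail iN); exact: Xc.
  have s1 : Num.sqrt (sumsq i.+1 N (fun I => bc i I / B i)) <= 1.
    by rewrite -sqrtr1 ler_wsqrtr// sumsq_normalized.
  by rewrite z'E -EFinM lee_fin ler_piMr// ltW.
have mWX i : (n <= i <= N)%N -> measurable_wrt
    <<s generators [set im | (i < im.1 <= N)%N] (fun im => xi im.1 im.2)>>
    (W i).
  move=> iN; apply: measurable_wrt_polyV_fin => j m jN.
  exact: (@measurable_wrt_generator _ _ _ P _
    [set im | (i < im.1 <= N)%N] (fun im => xi im.1 im.2) (j, lift ord0 m)).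
have theta_le k : (k < N.+1 - n)%N ->
    (pnorm P p (theta k) <= (z * c ord0)%:E)%E.
  move=> kN; have iN := itv_rev kN.
  (* [W (N - k)] involves only rows above [N - k], so the norm of the product factors. *)
  rewrite /theta /= (pnormM p (X := xi (N - k)%N ord0) (Y := W (N - k)%N)).
    by rewrite mulrC EFinM lee_pmul ?Lnorm_ge0 ?W_le ?Xc.
  apply: (@independent2_sigma _ _ _ P _ [set im | (n <= im.1 <= N)%N]
    [set im | (N - k < im.1 <= N)%N] (fun im => xi im.1 im.2)
    ((N - k)%N, ord0)) => //=.
  - by move=> [j m] /= /(itv_tail iN).
  - by rewrite ltnn.
  - exact: mWX.
rewrite (_ : polyV_fin _ _ _ _ =
    (fun w => \sum_(k < N.+1 - n) B (N - k)%N * theta k w)); last first.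
  apply/funext => w; rewrite polyV_finS big_rev_mkord.
  apply: eq_bigr => k _; rewrite subSS.
  by rewrite [X in _ * X](WE (N - k)%N w) mulrCA.
rewrite (_ : sumsq n N b = \sum_(k < N.+1 - n) B (N - k)%N ^+ 2); last first.
  rewrite sumsqS big_rev_mkord; apply: eq_bigr => k _.
  by rewrite subSS sqr_sqrtr// sumsq_ge0.
rewrite z'E -muleA -EFinM -muleA -EFinM mulrA.
apply: (@best_constant_le _ _ _ P _ p _ theta (fun k => B (N - k)%N)) => //.
- apply: (@reversed_martingale_differences _ _ _ P _ xi n N W) => //.
  + by move=> i; exact: cX.
  + move=> i iN; apply: (pnorm_integrable p1) => //.
    by apply: le_lt_trans (W_le _ iN) _; rewrite ltry.
- by rewrite mulr_ge0 ?ltW.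
Qed.

End moment_inequality.

(** * Norms of the classes G and reduction to one exponent *)

Section norms.
Context {disp : measure_display} {T : measurableType disp} {R : realType}.
Variable P : probability T R.
Local Open Scope ereal_scope.

Lemma prode_ge1 (I : Type) (s : seq I) (F : I -> \bar R) :
  (forall i, 1 <= F i) -> 1 <= \prod_(i <- s) F i.
Proof.
move=> F1; elim: s => [|i s IH]; first by rewrite big_nil.
rewrite big_cons -[leLHS]mule1; exact: lee_pmul.
Qed.

Lemma exponents_neq0 (r : \bar R) : 2%:E < r -> exponents r !=set0.
Proof.
case: r => [r| |] // r2.
  2: by exists 3%R; split; [rewrite ltr_nat|exact: ltry].
rewrite lte_fin in r2; exists ((2 + r) / 2)%R.
by split; rewrite ?lte_fin; [exact: (midf_lt r2).1|exact: (midf_lt r2).2].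
Qed.

(** At a single exponent, the supremum of the quotients times [psi p] dominates every norm in the
    family, hence their supremum [psi p]. *)
Lemma Gnorm_family_ge1 (D : set nat) (X : nat -> T -> R) (r : \bar R) :
  let psi p := nnsup [set pnorm P p (X i) | i in D] in
  2%:E < r -> (forall p, exponents r p -> 0 < psi p < +oo) ->
  1 <= Gnorm_family P psi r D X.
Proof.
move=> psi r2 psi_fin; have [p rp] := exponents_neq0 r2.
have /andP[psi0 psioo] := psi_fin p rp.
apply: le_trans; last first.
  by apply: le_nnsup; exists p; [exact: rp|reflexivity].
set S := nnsup _.
have [c psiE] : exists c, psi p = c%:E.
  by exists (fine (psi p)); rewrite fineK// ge0_fin_numE// ltW.
have c0 : (0 < c)%R by rewrite -lte_fin -psiE.
rewrite -(@lee_pmul2r _ c%:E)// mul1e -[leLHS]psiE.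
apply: ge_nnsup; first by rewrite mule_ge0 ?nnsup_ge0// lee_fin ltW.
move=> _ [i Di <-]; rewrite -lee_pdivrMr//; apply: le_nnsup; exists i => //.
by rewrite psiE inver gt_eqF.
Qed.

(** For [z = +oo] the inverse is 0 and so is the quotient, even if [x] is infinite. *)
Lemma lee_div1 (x z : \bar R) : 0 < z -> (z < +oo -> x <= z) -> x / z <= 1.
Proof.
case: z => [z| |//] z0 xz; last by rewrite invey mule0.
rewrite lte_fin in z0.
by rewrite inver gt_eqF// lee_pdivrMr// mul1e xz// ltry.
Qed.

End norms.

Lemma polyV_pnorm (disp : measure_display) (T : measurableType disp)
    (R : realType) (P : probability T R) (d n : nat) (N : option nat)
    (xi : nat -> 'I_d.+1 -> {RV P >-> R}) (b : coefs R d.+1) (p : R) :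
  (forall i m, in_range n N i -> centered P (xi i m)) ->
  independent_RVs [set im : nat * 'I_d.+1 | in_range n N im.1]
    (fun im => xi im.1 im.2) ->
  1 <= p -> (forall m, (0 < nu xi n N m p < +oo)%E) ->
  unit_coefs n N b -> polyV_defined xi n N b ->
  (pnorm P p (polyV xi n N b) / zeta1 xi n N p <= 1)%E.
Proof.
move=> cX indX p1 nu_fin b1 Vb.
have p0 : 0 < p by exact: lt_le_trans p1.
(* A positive supremum has a positive member other than the adjoined 0; this one variable tests both
   constants. *)
have [i0 iN /andP[t0 too]] : exists2 i, in_range n N i &
    (0 < pnorm P p (xi i ord0) < +oo)%E.
  have /andP[/ereal_sup_gt[_ [[i iN <-]|->] i0] nuoo] := nu_fin ord0;
    last first.
    by rewrite ltxx in i0.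
  exists i => //; rewrite i0/=; apply: le_lt_trans nuoo.
  by apply: le_nnsup; exists i.
have K1 C : C 1%N (fun=> xi i0 ord0) -> (0 < best_constant C p)%E.
  move=> CX; apply: lt_le_trans (best_constant_ge1 CX _); first exact: lte01.
  by rewrite t0.
have KI0 : (0 < KI P p)%E.
  apply: K1; split; last by move=> k _; exact: cX.
  apply: (@independent_RVs_reindex _ _ _ P _ _ _ _ _
    (fun=> (i0, ord0)) (fun=> 0%N) _ _ indX) => // k /=.
  by rewrite ltnS leqn0 => /eqP.
have KM0 : (0 < KM P p)%E.
  (* For a sequence of length one the condition on conditional expectations is vacuous, so a
     constant filtration serves. *)
  apply: K1; exists (fun=> measurable); split => //.
  - by split=> *; [exact: sigma_algebra_measurable|exact: subset_refl..].
  - by move=> k _ B mB; exact: measurable_funPTI.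
  - by move=> k _; exact: cX.
pose c m := fine (nu xi n N m p).
have cE m : nu xi n N m p = (c m)%:E.
  by have /andP[? ?] := nu_fin m; rewrite fineK// ge0_fin_numE// ltW.
have c0 m : 0 < c m by rewrite -lte_fin -cE; case/andP: (nu_fin m).
have zeta_gt0 : (0 < zeta_rec (KI P p) (KM P p)
    [seq (c m)%:E | m <- enum 'I_d.+1])%E.
  by apply: zeta_rec_gt0 => // _ /mapP[m _ ->]; rewrite lte_fin.
have zetaE : zeta1 xi n N p =
    zeta_rec (KI P p) (KM P p) [seq (c m)%:E | m <- enum 'I_d.+1].
  by rewrite /zeta1; congr zeta_rec; apply: eq_map => m.
apply: lee_div1; first by rewrite zetaE.
move=> zoo; have z0 : (0 <= zeta1 xi n N p)%E by rewrite zetaE ltW.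
(* A bound uniform in the truncation level: [k = N] settles the finite case, and all [k] together
   feed the limit. *)
have V_le k : (if N is Some N' then (k <= N')%N else true) ->
    (pnorm P p (polyV_fin xi n k b) <= zeta1 xi n N p)%E.
  move=> kN.
  have range_sub i : (n <= i <= k)%N -> in_range n N i.
    move=> /andP[ni ik]; rewrite /in_range ni /=.
    case: (N) kN => // N' kN; exact: leq_trans ik kN.
  apply: (@le_trans _ _ (zeta1 xi n N p * (Num.sqrt (sumsq n k b))%:E)%E).
    rewrite zetaE; apply: polyV_fin_pnorm => //.
    - by move=> J JD; apply: indX => im /JD /range_sub.
    - by move=> i m /range_sub; exact: cX.
    - move=> i m /range_sub iN'; rewrite -cE; apply: le_nnsup.
      by exists i.
    - by rewrite -zetaE.
  rewrite -[leRHS]mule1; apply: lee_wpmul2l => //.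
  rewrite lee_fin -sqrtr1; apply: ler_wsqrtr; exact: sumsq_le1 b1.
case: N {cX indX nu_fin iN c cE c0 zeta_gt0 zetaE} b1 Vb zoo z0 V_le =>
  [N|] b1 Vb zoo z0 V_le.
  exact: V_le.
apply: pnorm_lim => // k; first exact: measurable_polyV_fin.
exact: V_le.
Qed.

Theorem theorem7p2 (disp : measure_display) (T : measurableType disp)
    (R : realType) (P : probability T R)
    (d : nat) (hd : (1 <= d)%N)
    (n : nat) (hn : (1 <= n)%N)
    (N : option nat) (hN : in_range n N n)
    (xi : nat -> 'I_d -> {RV P >-> R})
    (hcent : forall (i : nat) (m : 'I_d), in_range n N i -> centered P (xi i m))
    (hindep : independent_RVs [set im : nat * 'I_d | in_range n N im.1]
                (fun im => xi im.1 im.2))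
    (r : 'I_d -> \bar R) (hr : forall m : 'I_d, (2%:E < r m)%E)
    (hnu : forall m : 'I_d, Gclass (r m) (nu xi n N m)) :
  let s : \bar R := (\big[Order.min/+oo]_(m < d) r m)%E in
  (nnsup [set Gnorm P (zeta1 xi n N) s (polyV xi n N b)
        | b in [set b | unit_coefs n N b /\ polyV_defined xi n N b]]
   <= \prod_(m < d) Gnorm_family P (nu xi n N m) (r m)
        [set i | in_range n N i] (fun i => xi i m))%E.
Proof.
cbv zeta; set s := (\big[Order.min/+oo]_(m < d) r m)%E.
have nu_fin m p : exponents (r m) p -> (0 < nu xi n N m p < +oo)%E.
  move=> [p2 pr]; case: (hnu m) => _ nuP _ _; apply/andP/nuP => //.
  by apply: le_trans (ltW p2); rewrite ler1n.
apply: (@le_trans _ _ 1%E); last first.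
  by apply: prode_ge1 => m; apply: Gnorm_family_ge1 => // p; exact: nu_fin.
apply: ge_nnsup => // _ [b [b1 Vb] <-]; apply: ge_nnsup => // _ [p [p2 ps] <-].
have p_exp m : exponents (r m) p.
  by split => //; apply: lt_le_trans ps _; exact: bigmin_le_cond.
(* With degree 0 excluded, the successor form provides the first column [ord0]. *)
case: d hd xi hcent hindep r hr hnu s nu_fin b b1 Vb ps p_exp => // d _ xi
  hcent hindep r hr hnu s nu_fin b b1 Vb ps p_exp.
apply: polyV_pnorm => //; first by apply: le_trans (ltW p2); rewrite ler1n.
by move=> m; exact: nu_fin.
Qed.
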